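(* Let $(\mathcal{M}, d_{\mathrm{GH}})$ be the Gromov-Hausdorff space and let $\mathcal{X},\mathcal{Y}\subset\mathcal{M}$ be bounded metric subspaces of $\mathcal{M}$. Then the product space $\mathcal{X}\times\mathcal{Y}$ equipped with the $\ell^\infty$ distance can be isometrically embedded into $(\mathcal{M}, d_{\mathrm{GH}})$.
   Context: The Gromov-Hausdorff space is the metric space $(\mathcal{M},d_{\mathrm{GH}})$, where $\mathcal{M}$ is a set of representatives of the isometry classes of nonempty compact metric spaces: every element of $\mathcal{M}$ is a nonempty compact metric space, every nonempty compact metric space is isometric to some element of $\mathcal{M}$, and two isometric elements of $\mathcal{M}$ are equal. For sets $X,Y$, let $\mathrm{GHC}(X,Y)$ be the collection of all subsets $R\subset X\times Y$ such that every $x\in X$ satisfies $(x,y)\in R$ for some $y\in Y$ and every $y\in Y$ satisfies $(x,y)\in R$ for some $x\in X$. For metric spaces $(X,d_X),(Y,d_Y)$ and $R\in\mathrm{GHC}(X,Y)$, the distortion is $\operatorname{dis}(R)=\sup\{|d_X(x,\xi)-d_Y(y,\eta)| \mid (x,y),(\xi,\eta)\in R\}$. The Gromov-Hausdorff distance is $d_{\mathrm{GH}}(X,Y)=\frac12\inf_{R\in\mathrm{GHC}(X,Y)}\operatorname{dis}(R)$. The $\ell^\infty$ distance on a product of two metric spaces is the maximum of the two coordinatewise distances. An isometric embedding is a distance-preserving map (not necessarily surjective). *)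

(* Defs.v *)
From HB Require Import structures.
From mathcomp Require Import all_boot all_order all_algebra.
From mathcomp Require Import all_classical all_reals all_analysis.

Set Implicit Arguments.
Unset Strict Implicit.
Unset Printing Implicit Defensive.

Import Order.TTheory GRing.Theory Num.Theory.

Local Open Scope classical_set_scope.
Local Open Scope ring_scope.

Record compactMetric (R : realType) := CompactMetric {
  cm_sort :> metricType R;
  cm_nonempty : [set: cm_sort] !=set0;
  cm_compact : compact [set: cm_sort]
}.

Definition isometric (R : realType) (X Y : metricType R) : Prop :=
  exists f : X -> Y,
    (forall x x', mdist (f x) (f x') = mdist x x') /\ range f = [set: Y].

Definition GHC (X Y : Type) : set (set (X * Y)) :=
  [set C | (forall x, exists y, C (x, y)) /\ (forall y, exists x, C (x, y))].

(* The supremum and the infimum are taken in \bar R, so that they are the true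
   ones even when the distances are unbounded; between nonempty compact spaces
   the resulting distance is finite. *)
Definition distortion (R : realType) (X Y : metricType R) (C : set (X * Y)) :
    \bar R :=
  ereal_sup [set e | exists p q : X * Y,
    [/\ C p, C q & e = `|mdist p.1 q.1 - mdist p.2 q.2|%:E]].

Definition dGH (R : realType) (X Y : metricType R) : \bar R :=
  ((2^-1)%:E * ereal_inf [set distortion C | C in @GHC X Y])%E.

(* An element a of M stands for the space sp a: the spaces are too large to be
   collected in a [set (compactMetric R)], so the set of representatives is
   given as the image of a (small) type M. *)
Definition is_GH_space (R : realType) (M : Type) (sp : M -> compactMetric R) :
    Prop :=
  (forall X : compactMetric R, exists a, isometric X (sp a)) /\
  (forall a b, isometric (sp a) (sp b) -> a = b).

Definition GH_dist (R : realType) (M : Type) (sp : M -> compactMetric R)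
    (a b : M) : \bar R := dGH (sp a) (sp b).

Definition dist_bounded (R : realType) (T : Type) (d : T -> T -> \bar R)
    (A : set T) : Prop :=
  exists c : R, forall x y, A x -> A y -> (d x y <= c%:E)%E.

Definition linf_dist (R : realType) (S T : Type) (dS : S -> S -> \bar R)
    (dT : T -> T -> \bar R) (p q : S * T) : \bar R :=
  maxe (dS p.1 q.1) (dT p.2 q.2).

(* A distance-preserving map from A, as a subspace of (S, dS), to (T, dT); the
   values of f outside A are irrelevant. *)
Definition isometric_embedding (R : realType) (S T : Type) (A : set S)
    (dS : S -> S -> \bar R) (dT : T -> T -> \bar R) (f : S -> T) : Prop :=
  forall x y, A x -> A y -> dT (f x) (f y) = dS x y.

(* Main.v *)
(** Let L bound the diameters of all the spaces in X and Y (one exists because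
    a space at GH-distance at most c from a space of diameter d has diameter at
    most d + 2c + 1).  To A and B associate the disjoint union of A, B and a
    point, these three blocks being at mutual distances 3L (A to B), 6L (B to
    the point) and 9L (A to the point).  These are pairwise distinct, and far
    enough apart from each other and from the distances inside a block that a
    correspondence of distortion less than L between two such unions respects
    the blocks, hence restricts to correspondences between the A-blocks and
    between the B-blocks; a correspondence of distortion at least L is
    irrelevant since the GH-distances at stake are at most L/2.  Conversely, the
    union of correspondences has the maximum of their distortions. *)

Require Import Defs.
From HB Require Import structures.
From mathcomp Require Import all_boot all_order all_algebra.
From mathcomp Require Import all_classical all_reals all_analysis.
From mathcomp Require Import lra zify.

Set Implicit Arguments.
Unset Strict Implicit.
Unset Printing Implicit Defensive.

Import Order.TTheory GRing.Theory Num.Theory.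
Import numFieldNormedType.Exports.

Local Open Scope classical_set_scope.
Local Open Scope ring_scope.

(** * Estimates on distortions, Gromov-Hausdorff distances and diameters *)

Section GromovHausdorff.
Context {R : realType}.
Implicit Types X Y : metricType R.

Lemma distortion_ge X Y (C : set (X * Y)) (x x' : X) (y y' : Y) :
  C (x, y) -> C (x', y') ->
  (`|mdist x x' - mdist y y'|%:E <= distortion C)%E.
Proof.
by move=> Cp Cq; apply: ereal_sup_ubound; exists (x, y), (x', y').
Qed.

Lemma distortion_le X Y (C : set (X * Y)) (e : \bar R) :
  (forall x y x' y', C (x, y) -> C (x', y') ->
    (`|mdist x x' - mdist y y'|%:E <= e)%E) ->
  (distortion C <= e)%E.
Proof.
move=> Ce; apply: ge_ereal_sup => _ [[x y] [[x' y'] [Cp Cq ->]]].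
exact: Ce.
Qed.

Lemma dGH_le X Y (C : set (X * Y)) : GHC C ->
  (dGH X Y <= (2^-1)%:E * distortion C)%E.
Proof.
move=> GC; rewrite /dGH lee_pmul2l ?lte_fin ?invr_gt0//.
by apply: ereal_inf_lbound; exists C.
Qed.

Lemma le_dGH X Y (m : \bar R) :
  (forall C : set (X * Y), GHC C -> (m <= (2^-1)%:E * distortion C)%E) ->
  (m <= dGH X Y)%E.
Proof.
move=> mC; rewrite /dGH lee_pdivlMl//.
by apply: le_ereal_inf_tmp => _ [C GC <-]; rewrite -lee_pdivlMl//; exact: mC.
Qed.

Lemma dGH_lt X Y (m : \bar R) : (dGH X Y < m)%E ->
  exists2 C : set (X * Y), GHC C & ((2^-1)%:E * distortion C < m)%E.
Proof.
move=> dm; apply: contrapT => noC; move: dm; apply/negP; rewrite -leNgt.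
apply: le_dGH => C GC; rewrite leNgt; apply/negP => Cm.
by apply: noC; exists C.
Qed.

Lemma isometric_sym X Y : isometric X Y -> isometric Y X.
Proof.
move=> [f [fd fs]].
have /choice[g gK] : forall y, exists x, f x = y.
  move=> y; have [x _ fx] : range f y by rewrite fs.
  by exists x.
exists g; split=> [y y'|]; first by rewrite -fd !gK.
rewrite -subTset => x _; exists (f x) => //.
by apply: mdist_positivity; rewrite -fd gK mdistxx.
Qed.

(** A correspondence pulls back along the two isometries, surjectivity making it total on both
    sides, and its distortion does not grow. *)
Lemma dGH_le_isometric X Y X' Y' : isometric X X' -> isometric Y Y' ->
  (dGH X Y <= dGH X' Y')%E.
Proof.
move=> [f [fd fs]] [g [gd gs]]; apply: le_dGH => C [CX CY].
apply: (le_trans (@dGH_le _ _ [set p | C (f p.1, g p.2)] _)).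
  split=> [x|y] /=.
    have [y' Cy'] := CX (f x); have [y _ gy] : range g y' by rewrite gs.
    by exists y; rewrite gy.
  have [x' Cx'] := CY (g y); have [x _ fx] : range f x' by rewrite fs.
  by exists x; rewrite fx.
rewrite lee_pmul2l ?lte_fin ?invr_gt0//.
by apply: distortion_le => x y x' y' /= Cp Cq; rewrite -fd -gd distortion_ge.
Qed.

Lemma dGH_isometric X Y X' Y' : isometric X X' -> isometric Y Y' ->
  dGH X Y = dGH X' Y'.
Proof.
move=> XX' YY'; apply/eqP; rewrite eq_le !dGH_le_isometric//;
  exact: isometric_sym.
Qed.

(** The full product is a correspondence, and two numbers of [0, d] differ by at most d. *)
Lemma dGH_le_diam X Y (x0 : X) (y0 : Y) (d : R) :
  (forall x x' : X, mdist x x' <= d) -> (forall y y' : Y, mdist y y' <= d) ->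
  (dGH X Y <= (2^-1 * d)%:E)%E.
Proof.
move=> Xd Yd; apply: (le_trans (@dGH_le _ _ setT _)).
  by split=> [x|y]; [exists y0|exists x0].
rewrite EFinM lee_pmul2l ?lte_fin ?invr_gt0//.
apply: distortion_le => x y x' y' _ _; rewrite lee_fin ler_norml.
have := Xd x x'; have := Yd y y'.
have := mdist_ge0 x x'; have := mdist_ge0 y y'; lra.
Qed.

Lemma diam_le_dGH X Y (d c : R) :
  (forall x x' : X, mdist x x' <= d) -> (dGH X Y <= c%:E)%E ->
  forall y y' : Y, mdist y y' <= d + 2 * c + 1.
Proof.
move=> Xd XYc y y'.
(* The infimum need not be attained: the slack 1/2 yields a correspondence of distortion less than
   2c + 1. *)
have [|C [CX CY] Cc] := @dGH_lt X Y (c + 2^-1)%:E.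
  by apply: le_lt_trans XYc _; rewrite lte_fin ltrDl.
have [x Cx] := CY y; have [x' Cx'] := CY y'.
have : ((2^-1 * `|mdist x x' - mdist y y'|)%:E < (c + 2^-1)%:E)%E.
  apply: le_lt_trans Cc; rewrite EFinM lee_pmul2l ?lte_fin ?invr_gt0//.
  exact: distortion_ge.
rewrite lte_fin; have := Xd x x'.
have := ler_norm (- (mdist x x' - mdist y y')); rewrite normrN.
lra.
Qed.

Lemma nonexpansive_continuous X (T : pseudoMetricType R) (f : X -> T) :
  (forall x x' e, mdist x x' < e -> ball (f x) e (f x')) -> continuous f.
Proof.
move=> fe x; apply/cvg_ballP => e e0; near=> z.
apply: fe; suff : ball x e z by rewrite ballEmdist.
near: z; exact: nbhsx_ballx.
Unshelve. all: by end_near. Qed.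

Lemma compact_image (T U : topologicalType) (f : T -> U) :
  continuous f -> compact [set: T] -> compact (range f).
Proof.
by move=> fc; apply: continuous_compact; exact: continuous_subspaceT.
Qed.

(** The distance to a base point is continuous, hence bounded, and the triangle inequality doubles
    the bound. *)
Lemma compact_diam X : compact [set: X] ->
  exists d : R, forall x x' : X, mdist x x' <= d.
Proof.
move=> cX; have [[x0 _]|/set0P/negP] := pselect ([set: X] !=set0); last first.
  rewrite negbK => /eqP X0; exists 0 => x; suff : [set: X] x by rewrite X0.
  by [].
have : compact (range (fun x : X => mdist x0 x : R^o)).
  apply: compact_image cX; apply: nonexpansive_continuous => x x' e xe.
  apply: le_lt_trans xe; rewrite ler_norml.
  have := metric_triangle x0 x x'; have := metric_triangle x0 x' x.
  rewrite (metric_sym x' x); lra.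
move=> /compact_bounded[M [_ /(_ (M + 1))]]; rewrite ltrDl ltr01 => /(_ isT) XM.
have {}XM x : mdist x0 x <= M + 1.
  by apply: le_trans (ler_norm _) (XM _ _); exists x.
exists ((M + 1) + (M + 1)) => x x'.
by apply: le_trans (metric_triangle x x0 x') _; rewrite (metric_sym x x0) lerD.
Qed.

End GromovHausdorff.

(** * The metric on the disjoint union of two spaces and a point *)

Section Gluing.
Context {R : realType}.

(** [L] is a parameter of the type so that the metric, which depends on it, can be inferred from the
    type. *)
Inductive gluing (A B : compactMetric R) (L : {posnum R}) : Type :=
  | GlueL of A
  | GlueR of B
  | GluePt.

Definition cm_point (A : compactMetric R) : A := projT1 (cid (cm_nonempty A)).

Variables (A B : compactMetric R) (L : {posnum R}).

Local Notation Z := (gluing A B L).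

(* The differences 1 - 0, 3 - 1 and 3 - 0 are distinct, so that the distances
   between labels determine the labels. *)
Definition glue_label (z : Z) : nat :=
  match z with GlueL _ => 0 | GlueR _ => 1 | GluePt => 3 end.

(** Subtraction on [nat] truncates, so this is the absolute difference of the labels. *)
Definition glue_gap (z w : Z) : nat :=
  (glue_label z - glue_label w) + (glue_label w - glue_label z).

Definition glue_fst (z : Z) : A := if z is GlueL a then a else cm_point A.

Definition glue_snd (z : Z) : B := if z is GlueR b then b else cm_point B.

(* This is the l^oo distance of the points (label, a, b), a point of the block A
   (resp. B) being completed with the base point of B (resp. A); when L bounds
   the diameters, the first coordinate dominates between different blocks. *)
Definition glue_dist (z w : Z) : R :=
  Num.max (3 * L%:num * (glue_gap z w)%:R)
    (Num.max (mdist (glue_fst z) (glue_fst w))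
             (mdist (glue_snd z) (glue_snd w))).

Lemma glue_distxx z : glue_dist z z = 0.
Proof. by rewrite /glue_dist /glue_gap subnn mulr0 !mdistxx !maxxx. Qed.

(** All three terms of the maximum vanish: the gap identifies the block, and the coordinate of that
    block identifies the point. *)
Lemma glue_dist_positivity z w : glue_dist z w = 0 -> z = w.
Proof.
move=> zw.
have : glue_dist z w <= 0 by rewrite zw.
rewrite !ge_max => /and3P[].
rewrite pmulr_rle0// lern0 => zw0 z1 z2; move: zw0.
have {z1} : mdist (glue_fst z) (glue_fst w) = 0.
  by apply/le_anti; rewrite z1 mdist_ge0.
have {z2} : mdist (glue_snd z) (glue_snd w) = 0.
  by apply/le_anti; rewrite z2 mdist_ge0.
by case: z w {zw} => [a|b|] [a'|b'|]//= => [_|] /mdist_positivity-> //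
  _ /mdist_positivity->.
Qed.

Lemma glue_dist_sym z w : glue_dist z w = glue_dist w z.
Proof.
rewrite /glue_dist /glue_gap addnC.
by rewrite (metric_sym (glue_fst z)) (metric_sym (glue_snd z)).
Qed.

Lemma glue_dist_triangle y x z :
  glue_dist x z <= glue_dist x y + glue_dist y z.
Proof.
have maxD (a b c d e f : R) : a <= b + c -> d <= e + f ->
    Num.max a d <= Num.max b e + Num.max c f.
  move=> abc def; rewrite ge_max.
  by rewrite (le_trans abc) ?(le_trans def)// lerD// le_max lexx ?orbT.
apply: (maxD); last by apply: maxD; exact: metric_triangle.
by rewrite -mulrDr ler_pM2l// -natrD ler_nat /glue_gap; lia.
Qed.

HB.instance Definition _ := gen_eqMixin Z.
HB.instance Definition _ := gen_choiceMixin Z.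
HB.instance Definition _ := isMetric.Build R Z
  glue_distxx glue_dist_positivity glue_dist_sym glue_dist_triangle.

End Gluing.

(** * Compactness of the gluing and its distances within and between blocks *)

Section GluingMetric.
Context {R : realType} {A B : compactMetric R} {L : {posnum R}}.
Implicit Types (z w : gluing A B L) (a : A) (b : B).

Lemma mdist_gluingE z w : mdist z w = glue_dist z w.
Proof. by []. Qed.

Lemma glue_compact : compact [set: gluing A B L].
Proof.
have cA : compact (range (@GlueL R A B L)).
  apply: compact_image (@cm_compact _ A).
  apply: nonexpansive_continuous => a a' e ae; rewrite ballEmdist /=.
  rewrite !gt_max /= mulr0 mdistxx ae.
  by rewrite (le_lt_trans (mdist_ge0 a a')).
have cB : compact (range (@GlueR R A B L)).
  apply: compact_image (@cm_compact _ B).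
  apply: nonexpansive_continuous => b b' e be; rewrite ballEmdist /=.
  rewrite !gt_max /= mulr0 mdistxx be.
  by rewrite (le_lt_trans (mdist_ge0 b b')).
have -> : [set: gluing A B L] =
    range (@GlueL R A B L) `|` range (@GlueR R A B L) `|` [set GluePt A B L].
  apply/seteqP; split=> // -[a|b|] _; last by right.
    by left; left; exists a.
  by left; right; exists b.
by apply: compactU; [apply: compactU|exact: compact_set1].
Qed.

Definition glue : compactMetric R :=
  @CompactMetric R (gluing A B L) (ex_intro _ (GluePt A B L) I) glue_compact.

Lemma mdist_GlueL a a' : mdist (GlueL B L a) (GlueL B L a') = mdist a a'.
Proof.
rewrite mdist_gluingE /glue_dist /glue_gap /= mulr0 mdistxx.
by rewrite (max_l (mdist_ge0 _ _)) (max_r (mdist_ge0 _ _)).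
Qed.

Lemma mdist_GlueR b b' : mdist (GlueR A L b) (GlueR A L b') = mdist b b'.
Proof.
rewrite mdist_gluingE /glue_dist /glue_gap /= mulr0 mdistxx.
by rewrite !(max_r (mdist_ge0 _ _)).
Qed.

Hypothesis hA : forall a a', mdist a a' <= L%:num.
Hypothesis hB : forall b b', mdist b b' <= L%:num.

Lemma mdist_gluing_neq z w : glue_label z <> glue_label w ->
  mdist z w = 3 * L%:num * (glue_gap z w)%:R.
Proof.
move=> zw; rewrite mdist_gluingE /glue_dist max_l// ge_max.
have L1 : L%:num <= 3 * L%:num * (glue_gap z w)%:R.
  have : 1 <= (glue_gap z w)%:R :> R by rewrite ler1n /glue_gap; lia.
  have : 0 < L%:num by []. nra.
by rewrite !(le_trans _ L1).
Qed.

(** Up to an error [L], distances are multiples of 3L; this is what lets a correspondence of small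
    distortion detect the gaps. *)
Lemma mdist_gluing_gap z w :
  `|mdist z w - 3 * L%:num * (glue_gap z w)%:R| <= L%:num.
Proof.
have [zw|/eqP zw] := eqVneq (glue_label z) (glue_label w); last first.
  by rewrite mdist_gluing_neq// subrr normr0.
have -> : glue_gap z w = 0%N by rewrite /glue_gap zw subnn.
rewrite mulr0 subr0 ger0_norm ?mdist_ge0//.
case: z w zw => [a|b|] [a'|b'|] //= _.
- by rewrite mdist_GlueL.
- by rewrite mdist_GlueR.
- by rewrite mdistxx.
Qed.

End GluingMetric.

(** * The Gromov-Hausdorff distance between two gluings *)

Section GluingDistance.
Context {R : realType} {A A' B B' : compactMetric R} {L : {posnum R}}.
Hypothesis hA : forall a a' : A, mdist a a' <= L%:num.
Hypothesis hA' : forall a a' : A', mdist a a' <= L%:num.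
Hypothesis hB : forall b b' : B, mdist b b' <= L%:num.
Hypothesis hB' : forall b b' : B', mdist b b' <= L%:num.

Local Notation Z := (gluing A B L).
Local Notation Z' := (gluing A' B' L).

Lemma GHC_label (C : set (Z * Z')) : GHC C ->
  (distortion C < L%:num%:E)%E ->
  forall z z', C (z, z') -> glue_label z = glue_label z'.
Proof.
move=> [CZ CZ'] CL.
(* The distortion and the two errors are at most L each, the first strictly, so the gaps differ by
   less than 1; being integers, they agree. *)
have gapE z w z' w' : C (z, z') -> C (w, w') -> glue_gap z w = glue_gap z' w'.
  move=> Cz Cw.
  have := le_lt_trans (distortion_ge Cz Cw) CL; rewrite lte_fin.
  have := mdist_gluing_gap hA hB z w; have := mdist_gluing_gap hA' hB' z' w'.
  rewrite !ler_norml ltr_norml => /andP[? ?] /andP[? ?] /andP[? ?].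
  have L0 : 0 < L%:num by [].
  have : (glue_gap z w)%:R < (glue_gap z' w')%:R + 1 :> R.
    by rewrite -(ltr_pM2l (_ : 0 < 3 * L%:num))//; lra.
  have : (glue_gap z' w')%:R < (glue_gap z w)%:R + 1 :> R.
    by rewrite -(ltr_pM2l (_ : 0 < 3 * L%:num))//; lra.
  rewrite !natr1 !ltr_nat; lia.
have [p' Cp] := CZ (GluePt A B L).
have [a' Ca] := CZ (GlueL B L (cm_point A)).
have [b' Cb] := CZ (GlueR A L (cm_point B)).
(* [p'] has gap 3 to [a'] and 2 to [b']. Gap 3 forces label 0 or 3, and label 0 would give [b'] the
   label 2, which no block has. *)
have p'3 : glue_label p' = 3%N.
  move: (gapE _ _ _ _ Cp Ca) (gapE _ _ _ _ Cp Cb).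
  by move: p' a' b' {Cp Ca Cb} => [?|?|] [?|?|] [?|?|].
(* As 3 is the largest label, the gap to it determines a label. *)
move=> z z' Cz; move: (gapE _ _ _ _ Cp Cz); rewrite /glue_gap p'3.
by case: z z' {Cz} => [?|?|] [?|?|].
Qed.

Definition glue_rel (CA : set (A * A')) (CB : set (B * B')) : set (Z * Z') :=
  [set p | match p with
           | (GlueL a, GlueL a') => CA (a, a')
           | (GlueR b, GlueR b') => CB (b, b')
           | (GluePt, GluePt) => True
           | _ => False
           end].

Lemma GHC_glue_rel CA CB : GHC CA -> GHC CB -> GHC (glue_rel CA CB).
Proof.
move=> [CA1 CA2] [CB1 CB2]; split.
- move=> [a|b|].
  + by have [a' Ca] := CA1 a; exists (GlueL _ _ a').
  + by have [b' Cb] := CB1 b; exists (GlueR _ _ b').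
  + by exists (GluePt _ _ _).
- move=> [a'|b'|].
  + by have [a Ca] := CA2 a'; exists (GlueL _ _ a).
  + by have [b Cb] := CB2 b'; exists (GlueR _ _ b).
  + by exists (GluePt _ _ _).
Qed.

Lemma distortion_glue_rel CA CB : GHC CA ->
  (distortion (glue_rel CA CB) <= maxe (distortion CA) (distortion CB))%E.
Proof.
(* Pairs in different blocks contribute 0, which must lie below the maximum; a supremum over the
   empty set would be -oo, hence the use of a point of [A]. *)
have m0 : GHC CA -> (0 <= maxe (distortion CA) (distortion CB))%E.
  move=> [CA1 _]; have [a' Ca'] := CA1 (cm_point A).
  by rewrite le_max (le_trans _ (distortion_ge Ca' Ca'))//.
move=> /m0{}m0; apply: distortion_le => z z' w w' zz' ww'.
have lz : glue_label z = glue_label z'.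
  by move: zz'; case: z z' => [?|?|] [?|?|].
have lw : glue_label w = glue_label w'.
  by move: ww'; case: w w' => [?|?|] [?|?|].
have [zw|/eqP zw] := eqVneq (glue_label z) (glue_label w); last first.
  rewrite mdist_gluing_neq// mdist_gluing_neq ?lz ?lw -?lz -?lw//.
  by rewrite /glue_gap lz lw subrr normr0.
case: z w z' w' zw {lz lw} zz' ww' =>
  [a|b|] [a1|b1|] // [a'|b'|] [a1'|b1'|] //= _.
- by move=> Ca Ca1; rewrite !mdist_GlueL le_max distortion_ge.
- by move=> Cb Cb1; rewrite !mdist_GlueR le_max distortion_ge ?orbT.
- by rewrite !mdistxx subrr normr0.
Qed.

Lemma dGH_glueL_le (C : set (Z * Z')) : GHC C ->
  (dGH A A' <= (2^-1)%:E * distortion C)%E.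
Proof.
(* Either half the distortion exceeds the diameter bound L/2, or labels are preserved and [C]
   restricts to the first blocks. *)
move=> GC; have [CL|CL] := leP L%:num%:E (distortion C).
  apply: le_trans (dGH_le_diam (cm_point A) (cm_point A') hA hA') _.
  by rewrite EFinM lee_pmul2l ?lte_fin ?invr_gt0.
have lab := GHC_label GC CL; case: GC => C1 C2.
apply: (le_trans (@dGH_le _ _ _
    [set p | C (GlueL B L p.1, GlueL B' L p.2)] _)).
  split=> [a|a'] /=.
    have [[a'|?|] Ca] := C1 (GlueL B L a); have := lab _ _ Ca => //= _.
    by exists a'.
  have [[a|?|] Ca] := C2 (GlueL B' L a'); have := lab _ _ Ca => //= _.
  by exists a.
rewrite lee_pmul2l ?lte_fin ?invr_gt0//; apply: distortion_le => a a' a1 a1'.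
by move=> /= Ca Ca1; have := distortion_ge Ca Ca1; rewrite !mdist_GlueL.
Qed.

Lemma dGH_glueR_le (C : set (Z * Z')) : GHC C ->
  (dGH B B' <= (2^-1)%:E * distortion C)%E.
Proof.
move=> GC; have [CL|CL] := leP L%:num%:E (distortion C).
  apply: le_trans (dGH_le_diam (cm_point B) (cm_point B') hB hB') _.
  by rewrite EFinM lee_pmul2l ?lte_fin ?invr_gt0.
have lab := GHC_label GC CL; case: GC => C1 C2.
apply: (le_trans (@dGH_le _ _ _
    [set p | C (GlueR A L p.1, GlueR A' L p.2)] _)).
  split=> [b|b'] /=.
    have [[?|b'|] Cb] := C1 (GlueR A L b); have := lab _ _ Cb => //= _.
    by exists b'.
  have [[?|b|] Cb] := C2 (GlueR A' L b'); have := lab _ _ Cb => //= _.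
  by exists b.
rewrite lee_pmul2l ?lte_fin ?invr_gt0//; apply: distortion_le => b b' b1 b1'.
by move=> /= Cb Cb1; have := distortion_ge Cb Cb1; rewrite !mdist_GlueR.
Qed.

Lemma dGH_gluing : dGH Z Z' = maxe (dGH A A') (dGH B B').
Proof.
apply/eqP; rewrite eq_le; apply/andP; split; last first.
  by apply: le_dGH => C GC; rewrite ge_max dGH_glueL_le ?dGH_glueR_le.
(* Arguing by contradiction turns the strict inequality into actual correspondences, with no
   minimizer required. *)
rewrite leNgt gt_max; apply/negP => /andP[].
move=> /dGH_lt[CA GA ltA] /dGH_lt[CB GB ltB].
have := dGH_le (GHC_glue_rel GA GB); apply/negP; rewrite -ltNge.
apply: (@le_lt_trans _ _ ((2^-1)%:E * maxe (distortion CA) (distortion CB))%E).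
  by rewrite lee_pmul2l ?lte_fin ?invr_gt0// distortion_glue_rel.
by rewrite maxe_pMr ?lee_fin ?invr_ge0// gt_max ltA.
Qed.

End GluingDistance.

(** * Uniform diameter bounds and the embedding *)

Lemma dist_bounded_diam (R : realType) (M : Type) (sp : M -> compactMetric R)
    (X : set M) : dist_bounded (GH_dist sp) X ->
  exists D : R, forall a, X a -> forall x x' : sp a, mdist x x' <= D.
Proof.
move=> [c Xc]; have [[a Xa]|X0] := pselect (X !=set0); last first.
  by exists 0 => a Xa; case: X0; exists a.
have [d ad] := compact_diam (@cm_compact _ (sp a)).
exists (d + 2 * c + 1) => b Xb.
by apply: diam_le_dGH ad _; exact: Xc.
Qed.

Theorem corollary1p4 (R : realType) (M : Type) (sp : M -> compactMetric R)
    (hM : is_GH_space sp) (X Y : set M)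
    (hX : dist_bounded (GH_dist sp) X) (hY : dist_bounded (GH_dist sp) Y) :
  exists f : M * M -> M,
    isometric_embedding (X `*` Y) (linf_dist (GH_dist sp) (GH_dist sp))
      (GH_dist sp) f.
Proof.
have [DX XD] := dist_bounded_diam hX; have [DY YD] := dist_bounded_diam hY.
(* Absolute values make the sum dominate both bounds whatever their signs; adding 1 makes it
   positive. *)
have L0 : 0 < `|DX| + `|DY| + 1 by rewrite ltr_wpDl// addr_ge0.
pose L := PosNum L0.
(* The gluing is only isometric to an element of the Gromov-Hausdorff space, so a representative is
   chosen for each pair. *)
have /choice[f fZ] : forall p : M * M, exists a,
    isometric (@glue R (sp p.1) (sp p.2) L) (sp a) by move=> p; exact: hM.1.
exists f => p q [/= Xp Yp] [/= Xq Yq].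
rewrite /GH_dist -(dGH_isometric (fZ p) (fZ q)).
have XL a : X a -> forall x x' : sp a, mdist x x' <= L%:num.
  move=> Xa x x'; apply: le_trans (XD _ Xa x x') _ => /=.
  by rewrite -addrA (le_trans (ler_norm _))// lerDl addr_ge0.
have YL a : Y a -> forall x x' : sp a, mdist x x' <= L%:num.
  move=> Ya x x'; apply: le_trans (YD _ Ya x x') _ => /=.
  by rewrite addrAC (le_trans (ler_norm _))// lerDr addr_ge0.
by apply: dGH_gluing; [exact: XL|exact: XL|exact: YL|exact: YL].
Qed.
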